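(* Let $T=(\Omega,(\Pi_i,t_i)_{i\in N})$ be an information structure. The following three statements are equivalent: (1) there is no common prior for $T$; (2) there exists an agreeable trade over $T$; (3) every probability distribution $p\in\Delta(\Omega)$ is a multiplayer money pump.
   Context: $\Omega$ is a finite nonempty set of states, $N=\{1,\dots,n\}$ is a finite nonempty set of players, and $\Delta(\Omega)$ is the set of probability measures on $\Omega$ (all subsets measurable). An information structure is a tuple $T=(\Omega,(\Pi_i,t_i)_{i\in N})$ where, for each $i$, $\Pi_i$ is a partition of $\Omega$ and $t_i\colon\Omega\to\Delta(\Omega)$ satisfies $t_i(\omega)(\pi_i(\omega))=1$ for every $\omega$, where $\pi_i(\omega)$ is the element of $\Pi_i$ containing $\omega$, and $t_i$ is constant on each element of $\Pi_i$. A prior of player $i$ is a $p\in\Delta(\Omega)$ such that $p(E\cap\pi)=t_i(\omega)(E)\,p(\pi)$ for all $E\subseteq\Omega$, $\pi\in\Pi_i$, $\omega\in\pi$; a common prior is a $p\in\Delta(\Omega)$ that is a prior of every player. A trade is a family $f=(f_i)_{i\in N}$ of functions $f_i\colon\Omega\to\mathbb{R}$ with $\sum_{i\in N}f_i(\omega)\le 0$ for all $\omega\in\Omega$; it is agreeable if $\int f_i\,\mathrm{d}t_i(\omega)>0$ for every $\omega\in\Omega$ and every $i\in N$. A nonempty set $S\subseteq\Omega$ is a common certainty component if for every $\omega\in S$ and $i\in N$ there is $E\subseteq S$ with $t_i(\omega)(E)=1$. An event $E\subseteq\Omega$ is commonly certain at $\omega$ if there is a common certainty component $S$ with $\omega\in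 S\subseteq E$. A semi-trade is a family $(f_i)_{i\in N}$ of functions $f_i\colon\Omega\to\mathbb{R}$ such that at every state $\omega\in\Omega$ the event $\{\omega'\in\Omega:\int f_i\,\mathrm{d}t_i(\omega')\ge 0\text{ for all }i\in N\}$ is commonly certain. A distribution $p\in\Delta(\Omega)$ is a multiplayer money pump if there exists a semi-trade $(f_i)_{i\in N}$ with $\int\sum_{i\in N}f_i\,\mathrm{d}p<0$. *)

(* Defs.v *)
From HB Require Import structures.
From mathcomp Require Import all_boot all_order all_algebra.
From mathcomp Require Import reals.

Set Implicit Arguments.
Unset Strict Implicit.
Unset Printing Implicit Defensive.

Import Order.TTheory GRing.Theory Num.Theory.
Local Open Scope ring_scope.

(** Probability measures on a finite type (every subset is measurable),
    represented by their mass functions; the boolean axiom makes this a subtype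
    of [{ffun T -> R}], so equality is equality of mass functions. *)
Record dist (R : realType) (T : finType) := Dist {
  mass :> {ffun T -> R};
  _ : [forall x, 0 <= mass x] && (\sum_x mass x == 1)
}.
HB.instance Definition _ (R : realType) (T : finType) :=
  [isSub for @mass R T].
HB.instance Definition _ (R : realType) (T : finType) :=
  [Choice of dist R T by <:].

Definition Pr (R : realType) (T : finType) (p : dist R T) (E : {set T}) : R :=
  \sum_(x in E) p x.

Definition Ex (R : realType) (T : finType) (p : dist R T) (f : T -> R) : R :=
  \sum_x f x * p x.

(** The player set is ['I_n]; [pblock (cells i) w] is the cell of player [i]'s
    partition that contains [w]. *)
Record info_structure (R : realType) (Omega : finType) (n : nat) := Info {
  cells : 'I_n -> {set {set Omega}};
  belief : 'I_n -> Omega -> dist R Omega;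
  cellsP : forall i, partition (cells i) [set: Omega];
  belief_cell : forall i w, Pr (belief i w) (pblock (cells i) w) = 1;
  belief_const : forall i (C : {set Omega}) w w', C \in cells i ->
    w \in C -> w' \in C -> belief i w = belief i w'
}.

Section Notions.
Variables (R : realType) (Omega : finType) (n : nat).
Variable T : info_structure R Omega n.
Implicit Types (p : dist R Omega) (f : 'I_n -> Omega -> R).

Definition prior (i : 'I_n) p : Prop :=
  forall (E C : {set Omega}) (w : Omega), C \in cells T i -> w \in C ->
    Pr p (E :&: C) = Pr (belief T i w) E * Pr p C.

Definition common_prior p : Prop := forall i, prior i p.

Definition trade f : Prop := forall w, \sum_i f i w <= 0.

Definition agreeable f : Prop := forall w i, 0 < Ex (belief T i w) (f i).

Definition common_certainty_component (S : {set Omega}) : Prop :=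
  S != set0 /\
  forall w i, w \in S ->
    exists2 E : {set Omega}, E \subset S & Pr (belief T i w) E = 1.

Definition commonly_certain (E : {set Omega}) (w : Omega) : Prop :=
  exists S : {set Omega},
    [/\ common_certainty_component S, w \in S & S \subset E].

Definition semi_trade f : Prop :=
  forall w, commonly_certain
    [set w' | [forall i, 0 <= Ex (belief T i w') (f i)]] w.

Definition money_pump p : Prop :=
  exists2 f, semi_trade f & Ex p (fun w => \sum_i f i w) < 0.

End Notions.

(* Main.v *)
Require Import Defs.
From mathcomp Require Import all_boot all_order all_algebra.
From mathcomp Require Import reals.
From mathcomp Require Import boolp ring lra.
Local Open Scope ring_scope.
Import Order.TTheory GRing.Theory Num.Theory.

(** If the linear system "every player strictly gains in expectation at every
    state, and the total is nonpositive" has no solution, Farkas' lemma gives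
    weights [l i w >= 0], not all zero, and [m w >= 0] such that
    [m = \sum_w l i w * t_i(w)] for every player [i].  The posteriors [t_i(w)]
    are priors of player [i], and priors are closed under mixing, so the
    normalization of [m] is a common prior.  Conversely, averaging over a common
    prior [p] gives [\int f_i dp = \int (\int f_i dt_i(w)) dp(w) >= 0] for each
    component of a semi-trade, so [p] is not a money pump; and an agreeable trade
    minus a small constant is a semi-trade whose total is everywhere negative. *)

(** Induction on [s] by elimination: if a vector [y] separating [b] from the tail violates the head
    constraint [k], all functionals are composed with the projection along [y] onto the kernel of
    [a k]. *)
Lemma farkas (R : realFieldType) (V : lmodType R) (J : eqType) (s : seq J)
    (a : J -> V -> R) (b : V -> R) :
    uniq s -> (forall j, scalar (a j)) -> scalar b ->
  (exists2 l : J -> R, forall j, 0 <= l j &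
     forall v, b v = \sum_(j <- s) l j * a j v) \/
  (exists2 v, forall j, j \in s -> 0 <= a j v & b v < 0).
Proof.
elim: s a b => [|k s IHs] a b /=.
  move=> _ _ lin_b; have [b0|] := pselect (forall v, b v = 0).
    by left; exists (fun=> 0) => // v; rewrite big_nil.
  move=> /existsNP[v /eqP bv]; right.
  have b0 : b 0 = 0 by have := lin_b (-1) 0 0; rewrite scaler0 addr0; lra.
  have bN u : b (- u) = - b u by have := lin_b (-1) u 0; rewrite scaleN1r addr0 b0; lra.
  case: (ltrgt0P (b v)) bv => // bv _; first by exists (- v) => //; rewrite bN; lra.
  by exists v.
move=> /andP[ks us] lin_a lin_b.
(* Since [k] is not in [s], its coefficient can be set without disturbing the tail. *)
have extend l c b' : (forall j, 0 <= l j) -> 0 <= c ->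
    (forall v, b' v = c * a k v + \sum_(j <- s) l j * a j v) ->
  exists2 l : J -> R, forall j, 0 <= l j &
     forall v, b' v = \sum_(j <- k :: s) l j * a j v.
  move=> l0 c0 bE; exists (fun j => if j == k then c else l j) => [j|v].
    by case: ifP.
  rewrite big_cons eqxx bE; congr (_ + _); apply: eq_big_seq => j js.
  by case: eqP => // jk; rewrite -jk js in ks.
case: (IHs a b us lin_a lin_b) => [[l l0 bE]|[y ay by0]].
  by left; apply: (extend l 0) => // v; rewrite bE mul0r add0r.
have [aky|aky] := leP 0 (a k y).
  by right; exists y => // j; rewrite inE => /predU1P[->//|/ay].
(* The new functional is [f] at [v - (a k v / a k y) *: y], where [a k] vanishes. *)
have lin_proj f : scalar f -> scalar (fun v => f v - f y / a k y * a k v).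
  by move=> lin_f c u v; rewrite lin_f lin_a; ring.
case: (IHs (fun j v => a j v - a j y / a k y * a k v)
           (fun v => b v - b y / a k y * a k v) us) => //.
- by move=> j; apply: lin_proj.
- exact: lin_proj.
- move=> [l l0 bE]; left.
  (* Collecting the multiples of [a k] gives this coefficient; it is nonnegative because [b y < 0],
     [a k y < 0] and [a j y >= 0] on [s]. *)
  apply: (extend l (b y / a k y - \sum_(j <- s) l j * (a j y / a k y))) => // [|v].
    rewrite subr_ge0; apply: (@le_trans _ _ 0).
      rewrite big_seq; apply: sumr_le0 => j js; rewrite mulr_ge0_le0 //.
      by rewrite mulr_ge0_le0 ?ay // invr_le0 ltW.
    by rewrite mulr_le0 ?invr_le0 // ltW.
  rewrite -[b v](subrKC (b y / a k y * a k v)) bE mulrBl -addrA; congr (_ + _).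
  rewrite mulr_suml addrC -sumrB; apply: eq_bigr => j _; ring.
(* The projection of [z] meets constraint [k] with equality. *)
- move=> [z az bz]; right; exists (- (a k z / a k y) *: y + z).
    move=> j; rewrite inE lin_a => /predU1P[->|/az].
      by rewrite mulNr divfK ?lt_eqF // addNr.
    by congr (_ <= _); ring.
  by rewrite lin_b; move: bz; congr (_ < _); ring.
Qed.

Section InformationStructure.
Context {R : realType} {Omega : finType} {n : nat}.
Variable T : info_structure R Omega n.
Implicit Types p : dist R Omega.

Lemma dist_ge0 p x : 0 <= p x.
Proof. by case: p => f /= /andP[/forallP]. Qed.

Lemma dist_sum1 p : \sum_x p x = 1.
Proof. by case: p => f /= /andP[_ /eqP]. Qed.

Lemma Pr_setT p : Pr p setT = 1.
Proof. by rewrite -(dist_sum1 p) /Pr; apply: eq_bigl => x; rewrite inE. Qed.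

Lemma Pr1_out p (C : {set Omega}) x : Pr p C = 1 -> x \notin C -> p x = 0.
Proof.
move=> pC xC; have := dist_sum1 p; rewrite (bigID (mem C)) /= -[X in X + _]/(Pr p C).
rewrite pC -[RHS]addr0 => /addrI /eqP.
by rewrite psumr_eq0 => [/allP/(_ x)|y _]; rewrite ?mem_index_enum ?xC ?dist_ge0 // => /(_ isT)/eqP.
Qed.

Lemma Pr1_setI p (E C : {set Omega}) : Pr p C = 1 -> Pr p (E :&: C) = Pr p E.
Proof.
move=> pC; rewrite [RHS](bigID (mem C)) /= [X in _ + X]big1 ?addr0.
  by apply: eq_bigl => x; rewrite inE.
by move=> x /andP[_ /(Pr1_out _ _ _ pC)].
Qed.

Lemma ExB_cst p (f : Omega -> R) c : Ex p (fun x => f x - c) = Ex p f - c.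
Proof.
rewrite /Ex -[c in RHS]mulr1 -(dist_sum1 p) mulr_sumr -sumrB.
by apply: eq_bigr => x _; rewrite mulrBl.
Qed.

Lemma Pr_belief_cell i (C : {set Omega}) w :
  C \in cells T i -> w \in C -> Pr (belief T i w) C = 1.
Proof.
move=> CT wC; have /and3P[_ tI _] := cellsP T i.
by rewrite -(belief_cell T i w) (def_pblock tI CT wC).
Qed.

Lemma belief_out_cell i (C : {set Omega}) w x :
  C \in cells T i -> w \notin C -> x \in C -> belief T i w x = 0.
Proof.
move=> CT wC xC; have /and3P[/eqP cov tI _] := cellsP T i.
apply: (Pr1_out _ _ _ (belief_cell T i w)).
apply: contra wC => xw; rewrite -(def_pblock tI CT xC).
by rewrite (same_pblock tI xw) mem_pblock cov inE.
Qed.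

(** This is the prior condition for [[set x]] and the cell of [x]: beliefs are constant on that
    cell, and those held outside it give [x] no mass. *)
Lemma prior_mean i p x : prior T i p -> p x = \sum_w p w * belief T i w x.
Proof.
move=> pr_p; have /and3P[/eqP cov tI _] := cellsP T i.
have xcov : x \in cover (cells T i) by rewrite cov inE.
set C := pblock (cells T i) x.
have CT : C \in cells T i by rewrite pblock_mem.
have xC : x \in C by rewrite mem_pblock.
have := pr_p [set x] C x CT xC.
have -> : [set x] :&: C = [set x] by apply/setIidPl; rewrite sub1set.
rewrite /Pr !big_set1 => ->; rewrite [RHS](bigID (mem C)) /=.
rewrite [X in _ = _ + X]big1 ?addr0; last first.
  by move=> w wC; rewrite (belief_out_cell i C) ?mulr0.
rewrite mulr_sumr; apply: eq_bigr => w wC.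
by rewrite mulrC (belief_const CT wC xC).
Qed.

(** In [Pr p (D :&: C)] only the weights of states in [C] survive, and the beliefs there all equal
    the one at [w]. Taking [D = setT] identifies the sum of these weights with [Pr p C]. *)
Lemma mean_prior i p (l : Omega -> R) :
  (forall x, p x = \sum_w l w * belief T i w x) -> prior T i p.
Proof.
move=> pE E C w CT wC.
have PrE D : Pr p (D :&: C) = Pr (belief T i w) D * \sum_(v in C) l v.
  rewrite /Pr; under eq_bigr do rewrite pE.
  rewrite exchange_big /= (bigID (mem C)) /= [X in _ + X]big1 ?addr0.
    rewrite mulr_sumr; apply: eq_bigr => v vC; rewrite -mulr_sumr mulrC.
    rewrite (belief_const CT wC vC); congr (_ * _).
    by rewrite -[LHS]/(Pr _ _) Pr1_setI // (Pr_belief_cell i).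
  move=> v vC; apply: big1 => x; rewrite inE => /andP[_ xC].
  by rewrite (belief_out_cell i C) ?mulr0.
by rewrite PrE -[C in Pr p C]setTI PrE Pr_setT mul1r.
Qed.

Lemma common_certainty_setT (w : Omega) : common_certainty_component T setT.
Proof.
split=> [|v i _]; first by apply/set0Pn; exists w; rewrite inE.
by exists setT; rewrite ?Pr_setT.
Qed.

(** An event commonly certain at a state contains that state, and the whole space is a common
    certainty component. *)
Lemma semi_tradeP f :
  semi_trade T f <-> forall i w, 0 <= Ex (belief T i w) (f i).
Proof.
split=> [f_st i w|f_ge0 w].
  by have [S [_ wS /subsetP/(_ w wS)]] := f_st w; rewrite inE => /forallP.
exists setT; split; rewrite ?inE //; first exact: (common_certainty_setT w).
by apply/subsetP => v _; rewrite inE; apply/forallP.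
Qed.

Lemma prior_Ex i p f : prior T i p ->
  Ex p f = \sum_w p w * Ex (belief T i w) f.
Proof.
move=> pr_p; rewrite /Ex; under eq_bigr do rewrite (prior_mean i) // mulr_sumr.
rewrite exchange_big; apply: eq_bigr => w _; rewrite mulr_sumr.
by apply: eq_bigr => x _; rewrite mulrCA.
Qed.

Lemma common_prior_not_money_pump p : common_prior T p -> ~ money_pump T p.
Proof.
move=> cp [f /semi_tradeP f_st]; apply/negP; rewrite -leNgt.
rewrite /Ex; under eq_bigr do rewrite mulr_suml.
rewrite exchange_big; apply: sumr_ge0 => i _ /=.
rewrite -[X in _ <= X]/(Ex p (f i)) (prior_Ex i) //.
by apply: sumr_ge0 => w _; rewrite mulr_ge0 ?dist_ge0.
Qed.

Lemma agreeable_trade_money_pump f p : (0 < n)%N ->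
  trade f -> agreeable T f -> money_pump T p.
Proof.
move=> n_gt0 f_tr f_ag.
(* The default 1 is positive, so [e] is a positive lower bound for all expected gains. *)
pose e := \big[Num.min/1]_(iw : 'I_n * Omega) Ex (belief T iw.1 iw.2) (f iw.1).
have e_gt0 : 0 < e.
  by rewrite /e; elim/big_ind: _ => // x y x0 y0; rewrite lt_min x0.
have e_le i w : e <= Ex (belief T i w) (f i).
  by rewrite /e (bigD1 (i, w)) //= ge_min lexx.
exists (fun i w => f i w - e).
  by apply/semi_tradeP => i w; rewrite ExB_cst subr_ge0.
have n_e : 0 < e *+ n by rewrite pmulrn_lgt0.
apply: (@le_lt_trans _ _ (- (e *+ n))); last by rewrite oppr_lt0.
rewrite -[leRHS]mulr1 -(dist_sum1 p) mulr_sumr; apply: ler_sum => w _.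
rewrite ler_wpM2r ?dist_ge0 // sumrB sumr_const card_ord.
by have := f_tr w; lra.
Qed.

Lemma no_common_prior_agreeable_trade : (0 < n)%N ->
    ~ (exists p, common_prior T p) ->
  exists f : 'I_n -> Omega -> R, trade f /\ agreeable T f.
Proof.
move=> n_gt0 no_cp.
(* A solution with positive slack [v.2] is an agreeable trade; the slack makes
   the strict inequalities accessible to Farkas' lemma. *)
pose V := ({ffun 'I_n * Omega -> R^o} * R^o)%type.
pose a (j : 'I_n * Omega + Omega) (v : V) : R :=
  match j with
  | inl (i, w) => Ex (belief T i w) (fun x => v.1 (i, x)) - v.2
  | inr w => - \sum_i v.1 (i, w)
  end.
(* [b v < 0] says that the slack is positive. *)
pose b (v : V) : R := - v.2.
have lin_a j : scalar (a j).
  move=> c u v; case: j => [[i w]|w] /=.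
    rewrite /Ex mulrBr mulr_sumr opprD addrACA -big_split /=; congr (_ + _).
    by apply: eq_bigr => x _; rewrite !ffunE /= -[_ *: _]/(_ * _); ring.
  rewrite mulrN -opprD mulr_sumr -big_split /=; congr (- _).
  by apply: eq_bigr => i _; rewrite !ffunE.
have lin_b : scalar b.
  by move=> c u v; rewrite /b /= -[_ *: _]/(_ * _); ring.
case: (farkas _ _ _ (index_enum _) a b (index_enum_uniq _) lin_a lin_b); last first.
  move=> [v av bv]; exists (fun i w => v.1 (i, w)); split=> [w|w i].
    by have := av (inr w) (mem_index_enum _); rewrite /= oppr_ge0.
  have := av (inl (i, w)) (mem_index_enum _); move: bv; rewrite /b /=; lra.
move=> [l l_ge0 lE]; case: no_cp.
pose m w := l (inr w).
(* Evaluate the Farkas identity at the indicator of coordinate [(i, x)] with zero slack. *)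
have mE i x : m x = \sum_w l (inl (i, w)) * belief T i w x.
  have := lE ([ffun ix => (ix == (i, x))%:R], 0).
  rewrite big_sumType /= /b /= oppr0 => /esym/eqP; rewrite addr_eq0 => /eqP.
  rewrite -sumrN.
  under [X in _ = X]eq_bigr do rewrite mulrN opprK.
  rewrite (bigD1 x) //= [X in _ = _ + X]big1 ?addr0; last first.
    move=> w wx; rewrite big1 ?mulr0 // => j _.
    by rewrite ffunE xpair_eqE (negPf wx) andbF.
  rewrite (bigD1 i) //= ffunE eqxx [X in _ = _ * (_ + X)]big1 ?addr0 ?mulr1; last first.
    by move=> j ji; rewrite ffunE xpair_eqE (negPf ji).
  rewrite -/(m x) => <-.
  (* Writing the index through its projections lets [pair_bigA] split the sum by player. *)
  rewrite (eq_bigr (fun jw => l (inl (jw.1, jw.2)) * (Ex (belief T jw.1 jw.2)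
    (fun y => ((jw.1, y) == (i, x))%:R)))); last first.
    move=> [j w] _ /=; rewrite addr0; congr (_ * _).
    by apply: eq_bigr => y _; rewrite ffunE.
  rewrite -(pair_bigA _ (fun j w => l (inl (j, w)) * (Ex (belief T j w)
    (fun y => ((j, y) == (i, x))%:R)))) /=.
  rewrite (bigD1 i) //= [X in _ + X = _]big1 ?addr0.
    apply: eq_bigr => w _; congr (_ * _).
    rewrite /Ex (bigD1 x) //= eqxx mul1r big1 ?addr0 // => y yx.
    by rewrite xpair_eqE (negPf yx) andbF mul0r.
  move=> j ji; apply: big1 => w _; rewrite /Ex big1 ?mulr0 // => y _.
  by rewrite xpair_eqE (negPf ji) mul0r.
have l_sum i : \sum_w l (inl (i, w)) = \sum_x m x.
  under [RHS]eq_bigr do rewrite (mE i).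
  rewrite exchange_big; apply: eq_bigr => w _.
  by rewrite -mulr_sumr dist_sum1 mulr1.
(* Evaluate at the zero family with slack -1: each expectation constraint contributes its weight,
   and the weights of each player sum to the mass of [m]. Hence [n] is the factor that normalizes
   [m]. *)
have m_sum : n%:R * \sum_x m x = 1.
  have := lE (0, -1); rewrite big_sumType /= /b /= opprK.
  rewrite [X in _ = _ + X -> _]big1 ?addr0 => [lE1|w _]; last first.
    by rewrite big1 ?oppr0 ?mulr0 // => i _; rewrite ffunE.
  rewrite [RHS]lE1 (eq_bigr (fun jw => l (inl (jw.1, jw.2)))); last first.
    move=> [j w] _ /=; rewrite /Ex big1 ?add0r ?opprK ?mulr1 // => y _.
    by rewrite ffunE mul0r.
  rewrite -(pair_bigA _ (fun j w => l (inl (j, w)))) /=.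
  under [RHS]eq_bigr do rewrite l_sum.
  by rewrite sumr_const card_ord mulr_natl.
have p_dist : [forall x, 0 <= [ffun x => n%:R * m x] x] &&
    (\sum_x [ffun x => n%:R * m x] x == 1).
  apply/andP; split; first by apply/forallP => x; rewrite ffunE mulr_ge0 ?ler0n ?l_ge0.
  by under eq_bigr do rewrite ffunE; rewrite -mulr_sumr m_sum.
exists (Dist p_dist) => i; apply: (mean_prior i _ (fun w => n%:R * l (inl (i, w)))).
by move=> x; rewrite /= ffunE (mE i) mulr_sumr; apply: eq_bigr => w _; rewrite mulrA.
Qed.

End InformationStructure.

Theorem theorem59 (R : realType) (Omega : finType) (n : nat)
    (Omega_gt0 : (0 < #|Omega|)%N) (n_gt0 : (0 < n)%N)
    (T : info_structure R Omega n) :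
  [<-> ~ (exists p : dist R Omega, common_prior T p);
       exists f : 'I_n -> Omega -> R, trade f /\ agreeable T f;
       forall p : dist R Omega, money_pump T p].
Proof.
split; first exact: no_common_prior_agreeable_trade.
split; first by move=> [f [f_tr f_ag]] p; apply: agreeable_trade_money_pump f_ag.
by move=> pump [p /common_prior_not_money_pump]; apply.
Qed.
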